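(* Let $\eta_1,\eta_2,\dots$ be independent standard Gaussian random variables. Then, as $n\to\infty$, $$\mathbb{E}\,\max\{|\eta_1|,\dots,|\eta_n|\} = \left( 1 + \frac{1+o(1)}{8n \log n}\right) \mathbb{E}\,\max\{\eta_1,\dots,\eta_{2n}\}.$$ *)

(* Defs.v *)
From HB Require Import structures.
From mathcomp Require Import all_boot all_order all_algebra.
From mathcomp Require Import all_classical all_reals all_analysis.
Set Implicit Arguments. Unset Strict Implicit. Unset Printing Implicit Defensive.
Import Order.TTheory GRing.Theory Num.Theory.
Local Open Scope classical_set_scope.
Local Open Scope ring_scope.

Definition mutually_independent d (T : measurableType d) (R : realType)
  (P : probability T R) (X : nat -> T -> R) : Prop :=
  forall (I : seq nat) (B : nat -> set R), uniq I ->
    (forall i, measurable (B i)) ->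
    P (\bigcap_(i in [set` I]) (X i @^-1` B i)) =
    (\prod_(i <- I) P (X i @^-1` B i))%E.

(* max{|eta_1|,...,|eta_n|} (pointwise; 0 for n = 0, irrelevant asymptotically) *)
Definition max_abs (T : Type) (R : realType) (X : nat -> T -> R) (n : nat) :
  T -> R := fun w => \big[Num.max/0]_(i < n) `|X i w|.

(* max{eta_1,...,eta_m} (pointwise; seeded with eta_1 so it is the genuine max
   for m >= 1) *)
Definition max_seq (T : Type) (R : realType) (X : nat -> T -> R) (m : nat) :
  T -> R := fun w => \big[Num.max/X 0%N w]_(i < m) X i w.

(* Main.v *)
Require Import Defs.
From HB Require Import structures.
From mathcomp Require Import all_boot all_order all_algebra.
From mathcomp Require Import all_classical all_reals all_analysis.
From mathcomp Require Import measurable_realfun ring lra.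
Import Order.TTheory GRing.Theory Num.Theory.
Import numFieldNormedType.Exports.
Local Open Scope classical_set_scope.
Local Open Scope ring_scope.

(* Let q be the standard Gaussian tail and phi the density. By the tail formula,
   the difference of the two expectations is
     int_0^oo ((1 - q)^(2n) - (1 - 2q)^n) dt + int_0^oo q^(2n) dt.
   The second integral is exponentially small. In the first, (1 - q)^2 exceeds
   1 - 2q by q^2, so the integrand lies between n q^2 (1 - 2q)^(n-1) and
   n q^2 (1 - q)^(2n-2). Around S = sqrt(2 ln n), where the integral
   concentrates, Mills' ratio gives q ~ phi / S; replacing one factor q by
   phi / S turns both bounds into S^-1 times exact derivatives, whose integrals
   are ~ 1 / (4n). So the difference is ~ 1 / (4 n S), while the expectation of
   the maximum is ~ S and S^2 = 2 ln n. *)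

(** The difference is of order 1/(n S), far below the bounded error to which either mean is
    estimated, so it has to be bounded as one integral of its own. With u = q(t), du = - phi dt, the
    two bounds become 1/S times beta integrals of n u (1 - u)^(2n-2) and n u (1 - 2u)^(n-1). Their
    mass lies at u of order 1/n, where (1 - u)^2 and 1 - 2u are indistinguishable; hence the common
    leading term. Mills' ratio can be frozen at a constant only on one side of a cut, and this
    dictates the ranges. The upper estimate works to the right of S - 1, and the part to its left is
    killed by the power of 1 - q. The lower estimate works on [1, S], and what is lost beyond S is
    of smaller order because n q(S) <= 1/S. Every relative error comes out as an explicit multiple
    of 1/S. *)

Section power_inequalities.
Context {R : realFieldType}.
Implicit Types (x y u : R).

(** * Elementary inequalities between powers *)

Lemma bernoulli_ineq u n : 0 <= u <= 1 -> 1 - n%:R * u <= (1 - u) ^+ n.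
Proof.
move=> /andP[u0 u1]; elim: n => [|n IH]; first by rewrite mul0r subr0 expr0.
rewrite exprS -natr1; have : 0 <= n%:R :> R by []; nra.
Qed.

(** The difference is x - y times the m + 1 products x^i y^(m-i), each at least y^m; for [subrX_le]
    each is at most x^m. *)
Lemma subrX_ge x y m : 0 <= y <= x ->
  m.+1%:R * (x - y) * y ^+ m <= x ^+ m.+1 - y ^+ m.+1.
Proof.
move=> /andP[y0 yx]; elim: m => [|m IH]; first by rewrite expr0 !expr1; lra.
have -> : x ^+ m.+2 - y ^+ m.+2 =
    y * (x ^+ m.+1 - y ^+ m.+1) + (x - y) * x ^+ m.+1 by rewrite !exprS; ring.
have h : y ^+ m.+1 <= x ^+ m.+1 by rewrite lerXn2r ?nnegrE// (le_trans y0).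
have -> : m.+2%:R * (x - y) * y ^+ m.+1 =
    y * (m.+1%:R * (x - y) * y ^+ m) + (x - y) * y ^+ m.+1.
  by rewrite -(natr1 m.+1) exprS; ring.
by apply: lerD; apply: ler_wpM2l => //; rewrite subr_ge0.
Qed.

Lemma subrX_le x y m : 0 <= y <= x ->
  x ^+ m.+1 - y ^+ m.+1 <= m.+1%:R * (x - y) * x ^+ m.
Proof.
move=> /andP[y0 yx]; have x0 := le_trans y0 yx.
elim: m => [|m IH]; first by rewrite expr0 !expr1; lra.
have -> : x ^+ m.+2 - y ^+ m.+2 =
    x * (x ^+ m.+1 - y ^+ m.+1) + (x - y) * y ^+ m.+1 by rewrite !exprS; ring.
have h : y ^+ m.+1 <= x ^+ m.+1 by rewrite lerXn2r ?nnegrE.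
have -> : m.+2%:R * (x - y) * x ^+ m.+1 =
    x * (m.+1%:R * (x - y) * x ^+ m) + (x - y) * x ^+ m.+1.
  by rewrite -(natr1 m.+1) exprS; ring.
by apply: lerD; apply: ler_wpM2l => //; rewrite subr_ge0.
Qed.

(** The bound u <= 1/2 keeps the base 1 - 2u nonnegative. For u = q(t) it amounts to t >= 0, which
    is why all integrals run over the positive axis. *)
Lemma gap_ge u m : 0 <= u <= 2^-1 ->
  m.+1%:R * u ^+ 2 * (1 - 2 * u) ^+ m <=
  (1 - u) ^+ (2 * m.+1) - (1 - 2 * u) ^+ m.+1.
Proof.
move=> /andP[u0 u1]; rewrite exprM.
have -> : u ^+ 2 = (1 - u) ^+ 2 - (1 - 2 * u) by ring.
by apply: subrX_ge; apply/andP; split; [lra|rewrite expr2; nra].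
Qed.

Lemma gap_ge0 u m : 0 <= u <= 2^-1 ->
  0 <= (1 - u) ^+ (2 * m.+1) - (1 - 2 * u) ^+ m.+1.
Proof.
move=> u01; apply: le_trans (gap_ge u m u01); move/andP: u01 => [u0 u1].
by rewrite !mulr_ge0 ?exprn_ge0//; lra.
Qed.

Lemma gap_le u m : 0 <= u <= 2^-1 ->
  (1 - u) ^+ (2 * m.+1) - (1 - 2 * u) ^+ m.+1 <=
  m.+1%:R * u ^+ 2 * (1 - u) ^+ (2 * m).
Proof.
move=> /andP[u0 u1]; rewrite !exprM.
have -> : u ^+ 2 = (1 - u) ^+ 2 - (1 - 2 * u) by ring.
by apply: subrX_le; apply/andP; split; [lra|rewrite expr2; nra].
Qed.

End power_inequalities.

(** * The Gaussian tail: derivative, symmetry, Mills' ratio *)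

Section gaussian_tail.
Context {R : realType}.
Notation mu := (@lebesgue_measure R).
Notation phi := (normal_pdf (0 : R) 1).

Lemma std_normal_pdfE (t : R) : phi t = normal_peak 1 * expR (- t ^+ 2 / 2).
Proof. by rewrite normal_pdfE ?oner_neq0// /normal_fun subr0 expr1n. Qed.

Lemma std_normal_pdf_gt0 (t : R) : 0 < phi t.
Proof.
by rewrite std_normal_pdfE mulr_gt0 ?expR_gt0// normal_peak_gt0 ?oner_neq0.
Qed.

Lemma std_normal_peak_le1 : normal_peak 1 <= 1 :> R.
Proof.
rewrite /normal_peak invf_le1; last first.
  by rewrite sqrtr_gt0 expr1n mul1r mulrn_wgt0// pi_gt0.
rewrite -[leLHS]sqrtr1 ler_sqrt expr1n mul1r; have := pi_ge2 R; first lra.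
by move=> ?; rewrite mulrn_wge0// pi_ge0.
Qed.

Lemma std_normal_pdfN (t : R) : phi (- t) = phi t.
Proof. by rewrite !std_normal_pdfE sqrrN. Qed.

Lemma is_derive_std_normal_pdf (t : R) : is_derive t 1 phi (- t * phi t).
Proof.
have -> : phi = normal_peak 1 \*: (expR \o (fun x : R => - x ^+ 2 / 2)).
  by apply/funext => x; rewrite /= std_normal_pdfE.
have h : is_derive t 1 (fun x : R => - x ^+ 2 / 2) (- t).
  by apply: is_derive_eq; rewrite /GRing.scale /=; field.
have H := is_derive1_comp (g := fun x : R => - x ^+ 2 / 2) (is_derive_expR _) h.
by apply: is_derive_eq; rewrite /= /GRing.scale/=; ring.
Qed.

Lemma continuous_std_normal_pdf : continuous phi.
Proof. by apply: continuous_normal_pdf; rewrite oner_neq0. Qed.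

Definition gauss_tail (t : R) : R := fine (normal_prob (0 : R) 1 `]t, +oo[).

Lemma normal_prob_itvoy (t : R) :
  normal_prob 0 1 `]t, +oo[ = (gauss_tail t)%:E.
Proof. by rewrite /gauss_tail fineK// fin_num_measure. Qed.

Lemma normal_prob_itvNyc (t : R) :
  normal_prob 0 1 `]-oo, t] = (1 - gauss_tail t)%:E.
Proof.
have -> : `]-oo, t]%classic = ~` `]t, +oo[%classic :> set R.
  by rewrite setCitvr.
by rewrite probability_setC//= normal_prob_itvoy EFinB.
Qed.

Lemma is_derive_gauss_tail (t : R) : is_derive t 1 gauss_tail (- phi t).
Proof.
have -> : gauss_tail =
  cst 1 - (fun x => \int[mu]_(s in [set` Interval -oo%O (BRight x)]) phi s)%R.
  apply/funext => x; rewrite !fctE /Rintegral.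
  have := normal_prob_itvNyc x; rewrite /normal_prob => ->/=; ring.
(* The point [t + 1] only provides room to the right of [t]. *)
have [] := @continuous_FTC1 R phi -oo%O t (t + 1).
- by rewrite ltrDl.
- exact: integrableS (integrable_normal_pdf 0 1).
- exact: ltNyr.
- exact: continuous_std_normal_pdf.
move=> dF F'; rewrite derive1E in F'.
have hF := DeriveDef dF F'.
by apply: is_derive_eq; rewrite sub0r.
Qed.

Lemma continuous_gauss_tail : continuous gauss_tail.
Proof.
move=> t; apply: differentiable_continuous; apply/derivable1_diffP.
exact: (ex_derive (is_derive := is_derive_gauss_tail t)).
Qed.

(** The identity, as a random variable on the Gaussian line, has [gauss_tail] as complementary
    distribution function; this gives the limit at infinity. *)
Let idR : measurableTypeR R -> R := idfun.
#[local] HB.instance Definition _ :=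
  @isMeasurableFun.Build _ _ _ _ idR (@measurable_id _ _ setT).

Lemma cvg_gauss_tail : gauss_tail t @[t --> +oo] --> 0.
Proof.
pose N : probability _ R := normal_prob (0 : R) 1.
have := @cvg_ccdfy0 _ _ R N (idR : {RV N >-> R}).
by move/fine_cvg.
Qed.

Lemma gauss_tail_ge0 (t : R) : 0 <= gauss_tail t.
Proof. by rewrite -lee_fin -normal_prob_itvoy measure_ge0. Qed.

Lemma gauss_tail_nincr : {homo gauss_tail : x y / x <= y >-> y <= x}.
Proof.
move=> x y xy; rewrite -lee_fin -!normal_prob_itvoy le_measure ?inE//.
exact: subset_itvr.
Qed.

Lemma gauss_tailN (t : R) : gauss_tail (- t) = 1 - gauss_tail t.
Proof.
suff : (1 - gauss_tail (- t))%:E = (gauss_tail t)%:E by move=> [<-]; ring.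
rewrite -normal_prob_itvNyc -normal_prob_itvoy /normal_prob.
rewrite ge0_integration_by_substitutionNy.
- rewrite integral_itv_obnd_cbnd; last first.
    apply/measurable_EFinP/measurable_funTS; exact: measurable_normal_pdf.
  by apply: eq_integral => x _; rewrite /= std_normal_pdfN.
- exact/continuous_subspaceT/continuous_std_normal_pdf.
- by move=> x _; exact: normal_pdf_ge0.
Qed.

Lemma gauss_tail0 : gauss_tail 0 = 2^-1.
Proof. by have := gauss_tailN 0; rewrite oppr0; lra. Qed.

Lemma gauss_tail_le_half (t : R) : 0 <= t -> gauss_tail t <= 2^-1.
Proof. by move=> t0; rewrite -gauss_tail0; exact: gauss_tail_nincr. Qed.

Lemma gauss_tail_itv (t : R) : 0 <= t -> 0 <= gauss_tail t <= 2^-1.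
Proof. by move=> t0; rewrite gauss_tail_ge0 gauss_tail_le_half. Qed.

(** A nonincreasing function stays above its limit. Each half of Mills' ratio compares two functions
    vanishing at infinity, so it reduces to the sign of one derivative. *)
Lemma derive_le0_cvg0_ge0 (f f' : R -> R) (a : R) :
  (forall x, a <= x -> is_derive x 1 f (f' x)) ->
  (forall x, a <= x -> f' x <= 0) -> f x @[x --> +oo] --> 0 -> 0 <= f a.
Proof.
move=> df f'0 f0.
have dec x : a <= x -> f x <= f a.
  move=> ax; apply: (@ler0_derive1_nincry _ f a) => //.
  - move=> y; rewrite in_itv/= andbT => /ltW ay.
    exact: (ex_derive (is_derive := df _ ay)).
  - move=> y; rewrite in_itv/= andbT => /ltW ay; rewrite derive1E.
    by have h := df _ ay; rewrite derive_val f'0.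
  - apply: derivable_within_continuous => y; rewrite in_itv/= andbT => ay.
    exact: (ex_derive (is_derive := df _ ay)).
rewrite -(cvg_lim _ f0)//; apply: limr_le; first by apply/cvg_ex; exists 0.
near=> x; apply: dec; near: x; apply: nbhs_pinfty_ge; exact: num_real.
Unshelve. all: by end_near. Qed.

Lemma cvg_std_normal_pdf : phi t @[t --> +oo] --> 0.
Proof.
have -> : phi = fun t => normal_peak 1 * gauss_fun (t * (Num.sqrt 2)^-1).
  apply/funext => t; rewrite std_normal_pdfE /gauss_fun; congr (_ * expR _).
  by rewrite exprMn exprVn sqr_sqrtr// mulNr.
rewrite -[0](mulr0 (normal_peak 1)); apply: cvgMr.
apply: cvg_comp cvg_gauss_fun.
by apply: gt0_cvgMly => //; rewrite invr_gt0 sqrtr_gt0.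
Qed.

Lemma cvg_invr_pinfty : x^-1 @[x --> +oo] --> (0 : R).
Proof.
apply: (gtr0_cvgV0 (f := id) _).2; last exact: cvg_id.
by apply: nbhs_pinfty_gt; exact: num_real.
Qed.

Lemma gauss_tail_le_mills (t : R) : 0 < t -> gauss_tail t <= phi t / t.
Proof.
move=> t0; rewrite -subr_ge0.
pose f (x : R) := phi x / x - gauss_tail x.
apply: (@derive_le0_cvg0_ge0 f (fun x => - phi x / x ^+ 2)).
- move=> x tx; have x0 : x != 0 by rewrite gt_eqF// (lt_le_trans t0).
  have h1 := is_derive_std_normal_pdf x; have h2 := is_derive_gauss_tail x.
  have h3 := is_deriveV x0 (is_derive_id x 1).
  by apply: is_derive_eq; rewrite /GRing.scale/=; field.
- move=> x tx; rewrite mulNr oppr_le0 mulr_ge0 ?normal_pdf_ge0//.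
  by rewrite invr_ge0 sqr_ge0.
- rewrite -[0](subrr (0 : R)); apply: cvgB; last exact: cvg_gauss_tail.
  have := cvgM cvg_std_normal_pdf cvg_invr_pinfty; rewrite mulr0.
  exact.
Qed.

(** The factor t / (1 + t^2) agrees with 1 / t up to relative order 1 / t^2, and the derivative of
    the difference has the same sign on the whole line, so no condition on [t] arises. *)
Lemma gauss_tail_ge_mills (t : R) : phi t * (t / (1 + t ^+ 2)) <= gauss_tail t.
Proof.
rewrite -subr_ge0.
pose f (x : R) := gauss_tail x - phi x * (x / (1 + x ^+ 2)).
apply: (@derive_le0_cvg0_ge0 f (fun x => - 2 * phi x / (1 + x ^+ 2) ^+ 2)).
- move=> x tx; have x0 : 1 + x ^+ 2 != 0 by rewrite gt_eqF// ltr_pwDl ?sqr_ge0.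
  have h1 := is_derive_std_normal_pdf x; have h2 := is_derive_gauss_tail x.
  have h4 : is_derive x 1 (fun y : R => 1 + y ^+ 2) (2 * x).
    by apply: is_derive_eq; rewrite /GRing.scale/=; ring.
  have h3 := is_deriveV (f := fun y : R => 1 + y ^+ 2) x0 h4.
  by apply: is_derive_eq; rewrite /GRing.scale/=; field.
- move=> x tx; rewrite 2!mulNr oppr_le0 !mulr_ge0 ?normal_pdf_ge0//.
  by rewrite invr_ge0 sqr_ge0.
- rewrite -[0](subrr (0 : R)); apply: cvgB; first exact: cvg_gauss_tail.
  apply: (@squeeze_cvgr _ _ _ _ (cst 0) phi); last 2 first.
  + exact: cvg_cst.
  + exact: cvg_std_normal_pdf.
  near=> x; have x0 : 0 <= x by near: x; apply: nbhs_pinfty_ge; exact: num_real.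
  have x1 : 0 < 1 + x ^+ 2 by rewrite ltr_pwDl ?sqr_ge0.
  rewrite /= mulr_ge0 ?normal_pdf_ge0 ?divr_ge0 ?(ltW x1)//=.
  rewrite ler_piMr ?normal_pdf_ge0// ler_pdivrMr//; nra.
Unshelve. all: by end_near. Qed.

Lemma gauss_tail_gt0 (t : R) : 0 < gauss_tail t.
Proof.
(* The lower Mills bound is positive only at positive arguments, so it is applied at a positive
   point to the right of [t]. *)
apply: (@lt_le_trans _ _ (gauss_tail (Num.max t 1))).
  apply: lt_le_trans (gauss_tail_ge_mills _).
  have m0 : 0 < Num.max t 1 by rewrite lt_max ltr01 orbT.
  by rewrite mulr_gt0 ?std_normal_pdf_gt0// divr_gt0// ltr_pwDl ?sqr_ge0.
by apply: gauss_tail_nincr; rewrite le_max lexx.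
Qed.

End gaussian_tail.

(** * Integrals of the tail over half-lines *)

Section gaussian_tail_integral.
Context {R : realType}.
Notation mu := (@lebesgue_measure R).
Notation phi := (normal_pdf (0 : R) 1).
Notation q := (@gauss_tail R).

Lemma continuous_exprn (f : R -> R) n :
  continuous f -> continuous (fun x => f x ^+ n).
Proof.
move=> cf x; apply: (@continuous_comp _ _ _ f (fun y => y ^+ n)).
  exact: cf.
exact: exprn_continuous.
Qed.

Lemma ge0_integral_itvcy_split (f : R -> R) (a b : R) : a <= b ->
  continuous f -> (forall x, a <= x -> 0 <= f x) ->
  (\int[mu]_(x in `[a, +oo[) (f x)%:E =
   \int[mu]_(x in `[a, b]) (f x)%:E + \int[mu]_(x in `[b, +oo[) (f x)%:E)%E.
Proof.
move=> ab cf f0.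
have mf D : measurable D -> measurable_fun D (EFin \o f).
  move=> mD; apply/measurable_EFinP/measurable_funTS.
  exact: continuous_measurable_fun.
have abE : `[a, b]%classic `|` `]b, +oo[%classic = `[a, +oo[%classic :> set R.
  by rewrite -itv_bndbnd_setU.
rewrite -abE ge0_integral_setU//.
- by congr (_ + _)%E; rewrite integral_itv_obnd_cbnd//; exact: mf.
- by apply: mf; rewrite abE.
- by move=> x; rewrite abE/= in_itv/= andbT lee_fin => /f0.
- apply/disj_setPS => x [] /=; rewrite !in_itv/= andbT => /andP[_ xb] bx.
  by move: (lt_le_trans bx xb); rewrite ltxx.
Qed.

Lemma ge0_le_integral_EFin (D : set R) (f g : R -> R) : measurable D ->
  continuous f -> continuous g ->
  (forall x, D x -> 0 <= f x) -> (forall x, D x -> f x <= g x) ->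
  (\int[mu]_(x in D) (f x)%:E <= \int[mu]_(x in D) (g x)%:E)%E.
Proof.
move=> mD cf cg f0 fg; apply: ge0_le_integral => //.
- by apply/measurable_EFinP/measurable_funTS; exact: continuous_measurable_fun.
- by apply/measurable_EFinP/measurable_funTS; exact: continuous_measurable_fun.
Qed.

Lemma integral_itvcc_cst (a b k : R) : a <= b ->
  (\int[mu]_(x in `[a, b]) k%:E)%E = (k * (b - a))%:E.
Proof.
move=> ab; rewrite integral_cst//= lebesgue_measure_itv/= lte_fin.
case: ltP => [//|ba]; have -> : b = a by apply/eqP; rewrite eq_le ab ba.
by rewrite subrr mulr0 mule0.
Qed.

Lemma integral_std_normal_pdf_itvcy (a : R) :
  (\int[mu]_(x in `[a, +oo[) (phi x)%:E)%E = (q a)%:E.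
Proof.
rewrite -normal_prob_itvoy /normal_prob integral_itv_obnd_cbnd//.
by apply/measurable_EFinP/measurable_funTS; exact: measurable_normal_pdf.
Qed.

(** Mills' ratio replaces q by phi / a on the whole range, and phi integrates back to q(a). *)
Lemma integral_gauss_tail_itvcy_le (a : R) : 0 < a ->
  (\int[mu]_(x in `[a, +oo[) (q x)%:E <= (q a / a)%:E)%E.
Proof.
move=> a0.
apply: (@le_trans _ _ (\int[mu]_(x in `[a, +oo[) (a^-1 * phi x)%:E)%E).
  apply: ge0_le_integral_EFin => //.
  - exact: continuous_gauss_tail.
  - by move=> x; apply: cvgMr; exact: continuous_std_normal_pdf.
  - by move=> x _; exact: gauss_tail_ge0.
  - move=> x /=; rewrite in_itv/= andbT => ax; have x0 := lt_le_trans a0 ax.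
    apply: (le_trans (gauss_tail_le_mills _ x0)).
    by rewrite mulrC ler_wpM2r ?normal_pdf_ge0// lef_pV2.
under eq_integral do rewrite EFinM.
rewrite ge0_integralZl_EFin//; last 3 first.
- by move=> x _; rewrite lee_fin normal_pdf_ge0.
- by apply/measurable_EFinP/measurable_funTS; exact: measurable_normal_pdf.
- by rewrite invr_ge0 ltW.
by rewrite integral_std_normal_pdf_itvcy -EFinM mulrC.
Qed.

(** The exact value is 1/sqrt(2 pi), but any constant would do: q <= 1/2 on [0, 1], and the rest is
    at most q(1) <= 1/2. *)
Lemma integral_gauss_tail_le1 :
  (\int[mu]_(x in `[0%R, +oo[) (q x)%:E <= 1)%E.
Proof.
rewrite (@ge0_integral_itvcy_split _ _ 1)//; last 2 first.
- exact: continuous_gauss_tail.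
- by move=> x _; exact: gauss_tail_ge0.
have h1 : (\int[mu]_(x in `[0%R, 1%R]) (q x)%:E <= (2^-1)%:E)%E.
  apply: (@le_trans _ _ (\int[mu]_(x in `[0%R, 1%R]) (2^-1)%:E)%E).
    apply: ge0_le_integral_EFin => //.
    - exact: continuous_gauss_tail.
    - by move=> x; exact: cvg_cst.
    - by move=> x _; exact: gauss_tail_ge0.
    - move=> x /=; rewrite in_itv/= => /andP[x0 _].
      exact: gauss_tail_le_half.
  by rewrite integral_itvcc_cst// subr0 mulr1.
apply: (le_trans (leeD h1 (integral_gauss_tail_itvcy_le _ ltr01))).
rewrite -EFinD lee_fin divr1; have := @gauss_tail_le_half R 1 ler01; lra.
Qed.

Lemma normal_prob_itvcc (t : R) : 0 <= t ->
  normal_prob 0 1 `[- t, t] = (1 - 2 * q t)%:E.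
Proof.
move=> t0.
have NtE : normal_prob 0 1 `]-oo, - t[ = (q t)%:E.
  rewrite /normal_prob integral_itv_bndo_bndc; last first.
    by apply/measurable_EFinP/measurable_funTS; exact: measurable_normal_pdf.
  have := normal_prob_itvNyc (- t); rewrite /normal_prob => ->.
  by rewrite gauss_tailN; congr (_%:E); ring.
have -> : `[- t, t]%classic = `]-oo, t]%classic `\` `]-oo, - t[%classic.
  apply/seteqP; split=> x /=; rewrite !in_itv/=.
    by move=> /andP[tx xt]; split => //; apply/negP; rewrite -leNgt.
  by move=> [xt /negP]; rewrite -leNgt => ->.
rewrite measureD//; last by rewrite -ge0_fin_numE// fin_num_measure.
rewrite setIidr; last first.
  by move=> x /=; rewrite !in_itv/= => xt; apply: ltW (lt_le_trans xt _); lra.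
transitivity ((1 - q t)%:E - (q t)%:E)%E.
  by congr (_ - _)%E; [exact: normal_prob_itvNyc|exact: NtE].
by rewrite -EFinB; congr (_%:E); ring.
Qed.

End gaussian_tail_integral.

(** * Tail formulas for the two expected maxima *)

Section maxima.
Context {R : realType} {d : measure_display} {T : measurableType d}.
Context {P : probability T R}.
Variable eta : nat -> {RV P >-> R}.
Notation mu := (@lebesgue_measure R).
Notation q := (@gauss_tail R).
Let X i : T -> R := eta i.

Lemma measurable_bigmax (g : T -> R) (Y : nat -> T -> R) n :
  measurable_fun [set: T] g -> (forall i, measurable_fun [set: T] (Y i)) ->
  measurable_fun [set: T] (fun w => \big[Num.max/g w]_(i < n) Y i w).
Proof.
move=> mg; elim: n Y => [|n IH] Y mY.
  by under eq_fun do rewrite big_ord0.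
under eq_fun do rewrite big_ord_recl.
by apply: measurable_maxr => //; exact: (IH (fun i => Y i.+1)).
Qed.

Lemma measurable_max_abs n : measurable_fun [set: T] (max_abs X n).
Proof.
apply: (measurable_bigmax (cst 0) (fun i w => `|X i w|)) => // i.
exact: measurableT_comp.
Qed.

Lemma measurable_max_seq n : measurable_fun [set: T] (max_seq X n).
Proof. by apply: (measurable_bigmax (X 0%N) X). Qed.

Let maxabs n : {RV P >-> R} := HB.pack (max_abs X n)
  (@isMeasurableFun.Build _ _ _ _ (max_abs X n) (measurable_max_abs n)).
Let maxseq n : {RV P >-> R} := HB.pack (max_seq X n)
  (@isMeasurableFun.Build _ _ _ _ (max_seq X n) (measurable_max_seq n)).

Lemma le_max_abs i n w : (i < n)%N -> `|X i w| <= max_abs X n w.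
Proof.
by move=> i_n; exact: (le_bigmax 0 (fun i : 'I_n => `|X i w|) (Ordinal i_n)).
Qed.

(** This domination gives integrability of [max_seq]. The seed [X 0] must be among the n variables,
    hence n > 0. *)
Lemma norm_max_seq_le n w : (0 < n)%N -> `|max_seq X n w| <= max_abs X n w.
Proof.
move=> n0; rewrite ler_norml; apply/andP; split.
  apply: (@le_trans _ _ (X 0%N w)).
    by have := le_max_abs 0 n w n0; rewrite ler_norml => /andP[].
  exact: bigmax_ge_id.
apply/bigmax_leP; split=> [|i _].
  exact: le_trans (ler_norm _) (le_max_abs _ _ _ n0).
exact: le_trans (ler_norm _) (le_max_abs _ _ _ (ltn_ord i)).
Qed.

Lemma preimage_max_abs n (t : R) : 0 <= t ->
  max_abs X n @^-1` `]-oo, t] =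
  \bigcap_(i in [set` iota 0 n]) (X i @^-1` `[- t, t]).
Proof.
move=> t0; apply/seteqP; split=> w /=.
  rewrite in_itv/= => Mt i /=; rewrite mem_iota add0n => /andP[_ i_n].
  by rewrite in_itv/= -ler_norml; exact: le_trans (le_max_abs _ _ _ i_n) Mt.
move=> h; rewrite in_itv/=; apply/bigmax_leP; split => // i _.
have /= := h i; rewrite mem_iota add0n ltn_ord => /(_ isT).
by rewrite in_itv/= ler_norml.
Qed.

Lemma preimage_max_seq n (t : R) : (0 < n)%N ->
  max_seq X n @^-1` `]-oo, t] =
  \bigcap_(i in [set` iota 0 n]) (X i @^-1` `]-oo, t]).
Proof.
move=> n0; apply/seteqP; split=> w /=.
  rewrite in_itv/= => /bigmax_leP[_ h] i /=.
  rewrite mem_iota add0n => /andP[_ i_n].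
  by rewrite in_itv/=; exact: (h (Ordinal i_n)).
have H i : (i < n)%N ->
    (\bigcap_(i in [set` iota 0 n]) (X i @^-1` `]-oo, t])) w ->
    X i w <= t.
  move=> i_n /(_ i) /=; rewrite mem_iota add0n i_n => /(_ isT).
  by rewrite in_itv.
move=> h; rewrite in_itv/=; apply/bigmax_leP; split => [|i _]; exact: H.
Qed.

Hypothesis hgauss : forall i (A : set R), measurable A ->
  distribution P (eta i) A = normal_prob 0 1 A.
Hypothesis hindep : mutually_independent P X.

Lemma probability_bigcap_iota n (B : set R) (p : R) : measurable B ->
  normal_prob 0 1 B = p%:E ->
  P (\bigcap_(i in [set` iota 0 n]) (X i @^-1` B)) = (p ^+ n)%:E.
Proof.
move=> mB Bp; rewrite (hindep _ (fun=> B) (iota_uniq 0 n))//.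
rewrite (eq_bigr (fun=> p%:E)); last by move=> i _; rewrite -Bp -(hgauss i).
rewrite -[in RHS](size_iota 0 n); elim: (iota 0 n) => [|k s IH].
  by rewrite big_nil expr0.
by rewrite big_cons IH exprS EFinM.
Qed.

Lemma expectation_max_abs n : ('E_P[max_abs X n] =
  \int[mu]_(t in `[0%R, +oo[) (1 - (1 - 2 * q t) ^+ n)%:E)%E.
Proof.
rewrite (@ge0_expectation_ccdf _ _ _ P (maxabs n)); last first.
  by move=> w; exact: bigmax_ge_id.
apply: eq_integral => t; rewrite inE/= in_itv/= andbT => t0.
rewrite ccdf_1_cdf /cdf /distribution /pushforward preimage_max_abs//.
by rewrite (probability_bigcap_iota _ _ (1 - 2 * q t))// normal_prob_itvcc.
Qed.

(** By Bernoulli the tail probability is at most 2 n q(t), which has finite integral. The two-sided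
    tail formula for [max_seq] relies on this. *)
Lemma integrable_max_abs n : P.-integrable [set: T] (EFin \o max_abs X n).
Proof.
apply/integrableP; split; first exact/measurable_EFinP/measurable_max_abs.
under eq_integral do rewrite /= ger0_norm ?bigmax_ge_id//.
have := expectation_max_abs n; rewrite unlock => ->.
apply: (@le_lt_trans _ _ (\int[mu]_(t in `[0%R, +oo[) ((2 * n%:R) * q t)%:E)%E).
  have cq : continuous (fun t => 1 - 2 * q t).
    move=> t; apply: cvgB; first exact: cvg_cst.
    by apply: cvgMr; exact: continuous_gauss_tail.
  apply: ge0_le_integral_EFin => //.
  - move=> t; apply: cvgB; first exact: cvg_cst.
    exact: (continuous_exprn _ _ cq).
  - by move=> t; apply: cvgMr; exact: continuous_gauss_tail.
  - move=> t /=; rewrite in_itv/= andbT => t0.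
    have /andP[? ?] := gauss_tail_itv _ t0.
    by rewrite subr_ge0 exprn_ile1//; lra.
  - move=> t /=; rewrite in_itv/= andbT => t0.
    suff : 1 - n%:R * (2 * q t) <= (1 - 2 * q t) ^+ n by lra.
    by apply: bernoulli_ineq; have /andP[? ?] := gauss_tail_itv _ t0; lra.
under eq_integral do rewrite EFinM.
rewrite ge0_integralZl_EFin//; last 2 first.
- by move=> x _; rewrite lee_fin gauss_tail_ge0.
- apply/measurable_EFinP/measurable_funTS; apply: continuous_measurable_fun.
  exact: continuous_gauss_tail.
apply: lte_mul_pinfty => //.
exact: le_lt_trans integral_gauss_tail_le1 (ltry _).
Qed.

(** For a signed variable the tail formula subtracts the integral of the distribution function over
    the negative axis. The reflection t -> - t turns 1 - q(-t) into q(t) there. *)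
Lemma expectation_max_seq n : (0 < n)%N -> ('E_P[max_seq X n] =
  \int[mu]_(t in `[0%R, +oo[) (1 - (1 - q t) ^+ n)%:E -
   \int[mu]_(t in `[0%R, +oo[) (q t ^+ n)%:E)%E.
Proof.
move=> n0.
have cdfE t : cdf (maxseq n) t = ((1 - q t) ^+ n)%:E.
  rewrite /cdf /distribution /pushforward preimage_max_seq//.
  by rewrite (probability_bigcap_iota _ _ (1 - q t))// normal_prob_itvNyc.
have cq : continuous (fun t => (1 - q t) ^+ n).
  apply: continuous_exprn => t.
  by apply: cvgB; [exact: cvg_cst|exact: continuous_gauss_tail].
rewrite (@expectation_cdf_ccdf _ _ _ P (maxseq n)); last first.
  apply/Lfun1_integrable; apply: le_integrable (integrable_max_abs n) => //.
    exact/measurable_EFinP/measurable_max_seq.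
  move=> w _ /=; rewrite lee_fin (le_trans (norm_max_seq_le _ _ n0))//.
  exact: ler_norm.
congr (_ - _)%E; first by apply: eq_integral => t _; rewrite ccdf_1_cdf cdfE.
under eq_integral do rewrite cdfE.
rewrite integral_itv_bndo_bndc; last first.
  by apply/measurable_EFinP/measurable_funTS; exact: continuous_measurable_fun.
rewrite -{1}oppr0 ge0_integration_by_substitutionNy.
- by apply: eq_integral => t _ /=; rewrite gauss_tailN subKr.
- exact: continuous_subspaceT.
(* [1 - q t] equals [q (- t)], hence is nonnegative for every real [t]. *)
- move=> t _; rewrite exprn_ge0// -[X in X - _](subrK (q (- t)) 1).
  by have := gauss_tail_ge0 (- t); rewrite gauss_tailN; lra.
Qed.

End maxima.

(** * Bounds for the integrals, with the cut points still free *)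

Section gauss_integral_bounds.
Context {R : realType}.
Notation mu := (@lebesgue_measure R).
Notation phi := (normal_pdf (0 : R) 1).
Notation q := (@gauss_tail R).

Let continuous_1Bq : continuous (fun t => 1 - q t).
Proof.
by move=> t; apply: cvgB; [exact: cvg_cst|exact: continuous_gauss_tail].
Qed.

Let continuous_1B2q : continuous (fun t => 1 - 2 * q t).
Proof.
move=> t; apply: cvgB; first exact: cvg_cst.
by apply: cvgMr; exact: continuous_gauss_tail.
Qed.

Let continuous_1B1BqX k : continuous (fun t => 1 - (1 - q t) ^+ k).
Proof.
move=> t; apply: cvgB; first exact: cvg_cst.
exact: (continuous_exprn _ _ continuous_1Bq).
Qed.

Let continuous_gap n :
  continuous (fun t => (1 - q t) ^+ (2 * n) - (1 - 2 * q t) ^+ n).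
Proof.
by move=> t; apply: cvgB; exact: (continuous_exprn _ _ _ t).
Qed.

Let is_derive_exprn (f : R -> R) (x df : R) n : is_derive x 1 f df ->
  is_derive x 1 (fun y => f y ^+ n) (n%:R * f x ^+ n.-1 * df).
Proof.
move=> h; have -> : (fun y => f y ^+ n) = f ^+ n.
  by apply/funext => y; rewrite exprfctE.
exact: is_deriveX.
Qed.

Let is_derive_1Bq (t : R) : is_derive t 1 (fun t => 1 - q t) (phi t).
Proof.
have h := is_derive_gauss_tail t.
by apply: is_derive_eq; ring.
Qed.

Let is_derive_1B2q (t : R) : is_derive t 1 (fun t => 1 - 2 * q t) (2 * phi t).
Proof.
have h := is_derive_gauss_tail t.
by apply: is_derive_eq; rewrite /GRing.scale/=; ring.
Qed.

(** All factors but one are at most 1/2, and the remaining one integrates to at most 1. *)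
Lemma integral_gauss_tailX_le k :
  (\int[mu]_(t in `[0%R, +oo[) (q t ^+ k.+1)%:E <= (2^-1 ^+ k)%:E)%E.
Proof.
apply: (@le_trans _ _
    (\int[mu]_(t in `[0%R, +oo[) (2^-1 ^+ k * q t)%:E)%E).
  apply: ge0_le_integral_EFin => //.
  - exact: (continuous_exprn _ _ continuous_gauss_tail).
  - by move=> t; apply: cvgMr; exact: continuous_gauss_tail.
  - by move=> t _; rewrite exprn_ge0// gauss_tail_ge0.
  - move=> t /=; rewrite in_itv/= andbT => /gauss_tail_itv/andP[q0 q1].
    by rewrite exprSr ler_wpM2r// lerXn2r// nnegrE.
under eq_integral do rewrite EFinM.
rewrite ge0_integralZl_EFin//; last 2 first.
- by move=> x _; rewrite lee_fin gauss_tail_ge0.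
- apply/measurable_EFinP/measurable_funTS; apply: continuous_measurable_fun.
  exact: continuous_gauss_tail.
rewrite -[leRHS]mule1; apply: lee_wpmul2l; first by rewrite lee_fin exprn_ge0.
exact: integral_gauss_tail_le1.
Qed.

(** A probability is at most 1 up to the cut [S]; beyond it the union bound k q(t) takes over. *)
Lemma integral_max_tail_le k (S : R) : 0 < S ->
  (\int[mu]_(t in `[0%R, +oo[) (1 - (1 - q t) ^+ k)%:E <=
   (S + k%:R * (q S / S))%:E)%E.
Proof.
move=> S0.
have f0 t : 0 <= t -> 0 <= 1 - (1 - q t) ^+ k.
  by move=> /gauss_tail_itv/andP[q0 q1]; rewrite subr_ge0 exprn_ile1//; lra.
rewrite (@ge0_integral_itvcy_split _ _ _ S) ?(ltW S0)//.
rewrite EFinD; apply: leeD.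
  apply: (@le_trans _ _ (\int[mu]_(t in `[0%R, S]) 1%:E)%E); last first.
    by rewrite integral_itvcc_cst ?(ltW S0)// subr0 mul1r.
  apply: ge0_le_integral_EFin => //.
  - by move=> t; exact: cvg_cst.
  - by move=> t /=; rewrite in_itv/= => /andP[t0 _]; exact: f0.
  - move=> t /=; rewrite in_itv/= => /andP[/gauss_tail_itv/andP[q0 q1] _].
    by rewrite gerBl exprn_ge0//; lra.
apply: (@le_trans _ _ (\int[mu]_(t in `[S, +oo[) (k%:R * q t)%:E)%E).
  apply: ge0_le_integral_EFin => //.
  - by move=> t; apply: cvgMr; exact: continuous_gauss_tail.
  - move=> t /=; rewrite in_itv/= andbT => St; apply: f0.
    exact: le_trans (ltW S0) St.
  - move=> t /=; rewrite in_itv/= andbT => St.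
    have /gauss_tail_itv/andP[q0 q1] : 0 <= t by exact: le_trans (ltW S0) St.
    suff : 1 - k%:R * q t <= (1 - q t) ^+ k by lra.
    by apply: bernoulli_ineq; lra.
under eq_integral do rewrite EFinM.
rewrite ge0_integralZl_EFin//; last 2 first.
- by move=> x _; rewrite lee_fin gauss_tail_ge0.
- apply/measurable_EFinP/measurable_funTS; apply: continuous_measurable_fun.
  exact: continuous_gauss_tail.
rewrite [leRHS]EFinM; apply: lee_wpmul2l; first by rewrite lee_fin.
exact: integral_gauss_tail_itvcy_le.
Qed.

Lemma integral_max_tail_ge k (s : R) : 0 <= s ->
  ((s * (1 - (1 - q s) ^+ k))%:E <=
   \int[mu]_(t in `[0%R, +oo[) (1 - (1 - q t) ^+ k)%:E)%E.
Proof.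
move=> s0.
have f0 t : 0 <= t -> 0 <= 1 - (1 - q t) ^+ k.
  by move=> /gauss_tail_itv/andP[q0 q1]; rewrite subr_ge0 exprn_ile1//; lra.
rewrite (@ge0_integral_itvcy_split _ _ _ s)//.
apply: (@le_trans _ _ (\int[mu]_(t in `[0%R, s]) (1 - (1 - q t) ^+ k)%:E)%E);
  last first.
  apply: leeDl; apply: integral_ge0 => t /=; rewrite in_itv/= andbT => st.
  by rewrite lee_fin f0// (le_trans s0).
apply: (@le_trans _ _ (\int[mu]_(t in `[0%R, s]) (1 - (1 - q s) ^+ k)%:E)%E).
  by rewrite integral_itvcc_cst// subr0 mulrC.
apply: ge0_le_integral_EFin => //.
- by move=> t; exact: cvg_cst.
- by move=> t _; exact: f0.
- move=> t /=; rewrite in_itv/= => /andP[t0 ts].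
  have := gauss_tail_nincr _ _ ts.
  have /andP[? ?] := gauss_tail_itv _ t0.
  have /andP[? ?] := gauss_tail_itv _ s0.
  move=> ?.
  by rewrite lerD2l lerN2 lerXn2r ?nnegrE//; lra.
Qed.

(* [F] is minus the primitive of [u |-> n u (1 - u)^(2m)], n = m + 1, evaluated
   at [q t]: since [q' = - phi], the integrand is exactly [F']. *)
Lemma integral_gauss_tail_pdf_le m (s : R) : 0 <= s ->
  (\int[mu]_(t in `[s, +oo[) (m.+1%:R * q t * (1 - q t) ^+ (2 * m) * phi t)%:E
   <= ((2 * (2 * m).+1%:R)^-1)%:E)%E.
Proof.
move=> s0.
pose F t := m.+1%:R * ((1 - q t) ^+ (2 * m).+1 / (2 * m).+1%:R
                       - (1 - q t) ^+ (2 * m).+2 / (2 * m).+2%:R).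
have dF (t : R) :
    is_derive t 1 F (m.+1%:R * q t * (1 - q t) ^+ (2 * m) * phi t).
  have h1 := is_derive_exprn _ _ _ (2 * m).+1 (is_derive_1Bq t).
  have h2 := is_derive_exprn _ _ _ (2 * m).+2 (is_derive_1Bq t).
  apply: is_derive_eq; rewrite /GRing.scale/= (exprS (1 - q t)).
  have m0 : 0 <= m%:R :> R by [].
  field; apply/andP; split; apply: lt0r_neq0; lra.
have cf : continuous (fun t => m.+1%:R * q t * (1 - q t) ^+ (2 * m) * phi t).
  move=> t; apply: cvgM; last exact: continuous_std_normal_pdf.
  apply: cvgM; first by apply: cvgMr; exact: continuous_gauss_tail.
  exact: (continuous_exprn _ _ continuous_1Bq).
rewrite (@ge0_continuous_FTC2y _ _ F s (2 * (2 * m).+1%:R)^-1).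
- rewrite -EFinB lee_fin gerBl /F mulr_ge0//.
  have /andP[q0 q1] := gauss_tail_itv _ s0.
  rewrite subr_ge0 ler_pM ?invr_ge0 ?exprn_ge0//; [lra| |].
    by apply: ler_wiXn2l => //; lra.
  by rewrite lef_pV2 ?posrE// ler_nat.
- move=> x sx; have x0 := le_trans s0 sx.
  have /andP[? ?] := gauss_tail_itv _ x0.
  by rewrite !mulr_ge0 ?normal_pdf_ge0 ?exprn_ge0//; lra.
- exact: continuous_subspaceT.
(* This is [F] at q = 0: (m + 1) (1/(2m+1) - 1/(2m+2)) = 1/(2 (2m+1)), the source of 1/(4n). *)
- have -> : (2 * (2 * m).+1%:R)^-1 = 
    m.+1%:R * ((1 - 0) ^+ (2 * m).+1 / (2 * m).+1%:R
                       - (1 - 0) ^+ (2 * m).+2 / (2 * m).+2%:R) :> R.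
    rewrite subr0 !expr1n; have m0 : 0 <= m%:R :> R by [].
    field; apply/andP; split; apply: lt0r_neq0; lra.
  have cq : (1 - q t) @[t --> +oo] --> (1 - 0 : R).
    by apply: cvgB; [exact: cvg_cst|exact: cvg_gauss_tail].
  have cqX k : (1 - q t) ^+ k @[t --> +oo] --> ((1 - 0) ^+ k : R).
    by apply: (cvg_comp _ (fun y : R => y ^+ k) cq); exact: exprn_continuous.
  by apply: cvgMr; apply: cvgB; apply: cvgMl; exact: cqX.
- by move=> x _; exact: (ex_derive (is_derive := dF x)).
- apply: cvg_at_right_filter; apply: differentiable_continuous.
  by apply/derivable1_diffP; exact: (ex_derive (is_derive := dF s)).
- by move=> x _; have h := dF x; rewrite derive1E derive_val.
Qed.

(** Left of [s], q^2 <= 1 and the power of 1 - q is largest at [s]; right of [s], Mills' ratio gives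
    q <= phi / s for one of the two factors q. *)
Lemma integral_gap_le m (s : R) : 0 < s ->
  (\int[mu]_(t in `[0%R, +oo[)
     ((1 - q t) ^+ (2 * m.+1) - (1 - 2 * q t) ^+ m.+1)%:E <=
   (m.+1%:R * s * (1 - q s) ^+ (2 * m) + s^-1 * (2 * (2 * m).+1%:R)^-1)%:E)%E.
Proof.
move=> s0.
have f0 t : 0 <= t -> 0 <= (1 - q t) ^+ (2 * m.+1) - (1 - 2 * q t) ^+ m.+1.
  by move=> /gauss_tail_itv; exact: gap_ge0.
rewrite (@ge0_integral_itvcy_split _ _ _ s) ?(ltW s0)//.
rewrite EFinD; apply: leeD.
  apply: (@le_trans _ _
      (\int[mu]_(t in `[0%R, s]) (m.+1%:R * (1 - q s) ^+ (2 * m))%:E)%E);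
    last first.
    by rewrite integral_itvcc_cst ?(ltW s0)// subr0 mulrAC.
  apply: ge0_le_integral_EFin => //.
  - by move=> t; exact: cvg_cst.
  - by move=> t /=; rewrite in_itv/= => /andP[t0 _]; exact: f0.
  - move=> t /=; rewrite in_itv/= => /andP[t0 ts].
    apply: (le_trans (gap_le _ _ (gauss_tail_itv _ t0))).
    have /andP[q0 q1] := gauss_tail_itv _ t0.
    have /andP[r0 r1] := gauss_tail_itv _ (ltW s0).
    rewrite -mulrA ler_wpM2l//.
    rewrite -[leRHS]mul1r ler_pM ?sqr_ge0 ?exprn_ge0//; try lra.
      by rewrite expr_le1//; lra.
    by rewrite lerXn2r ?nnegrE//; have := gauss_tail_nincr _ _ ts; lra.
apply: (@le_trans _ _ (\int[mu]_(t in `[s, +oo[)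
    (s^-1 * (m.+1%:R * q t * (1 - q t) ^+ (2 * m) * phi t))%:E)%E).
  apply: ge0_le_integral_EFin => //.
  - move=> t; apply: cvgMr; apply: cvgM; last exact: continuous_std_normal_pdf.
    apply: cvgM; first by apply: cvgMr; exact: continuous_gauss_tail.
    exact: (continuous_exprn _ _ continuous_1Bq).
  - move=> t /=; rewrite in_itv/= andbT => st; apply: f0.
    exact: le_trans (ltW s0) st.
  - move=> t /=; rewrite in_itv/= andbT => st.
    have t0 := lt_le_trans s0 st.
    apply: (le_trans (gap_le _ _ (gauss_tail_itv _ (ltW t0)))).
    have /andP[q0 q1] := gauss_tail_itv _ (ltW t0).
    have h : q t <= s^-1 * phi t.
      apply: (le_trans (gauss_tail_le_mills _ t0)).
      by rewrite mulrC ler_wpM2r ?normal_pdf_ge0// lef_pV2.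
    have -> : m.+1%:R * q t ^+ 2 * (1 - q t) ^+ (2 * m) =
      (m.+1%:R * q t * (1 - q t) ^+ (2 * m)) * q t by ring.
    rewrite [leRHS]mulrCA ler_wpM2l// !mulr_ge0 ?exprn_ge0//; lra.
under eq_integral do rewrite EFinM.
rewrite ge0_integralZl_EFin//; last 3 first.
- move=> x /=; rewrite in_itv/= andbT => sx.
  have x0 := le_trans (ltW s0) sx; have /andP[? ?] := gauss_tail_itv _ x0.
  by rewrite lee_fin !mulr_ge0 ?normal_pdf_ge0 ?exprn_ge0//; lra.
- apply/measurable_EFinP/measurable_funTS; apply: continuous_measurable_fun.
  move=> t; apply: cvgM; last exact: continuous_std_normal_pdf.
  apply: cvgM; first by apply: cvgMr; exact: continuous_gauss_tail.
  exact: (continuous_exprn _ _ continuous_1Bq).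
- by rewrite invr_ge0 ltW.
rewrite [leRHS]EFinM; apply: lee_wpmul2l; first by rewrite lee_fin invr_ge0 ltW.
exact: integral_gauss_tail_pdf_le (ltW s0).
Qed.

(** Only [1, S] is kept: t / (1 + t^2) decreases from t = 1 on, so the lower Mills factor may be
    frozen at its value at [S]. The integrand is then an exact derivative, and the two terms in the
    bound come from the ends [S] and 1. *)
Lemma integral_gap_ge m (S : R) : 1 < S ->
  ((S / (1 + S ^+ 2) * ((1 - (2 * m.+1%:R * q S) ^+ 2) / (4 * m.+2%:R)
     - (1 - 2 * q 1) ^+ m.+1 / 4))%:E <=
   \int[mu]_(t in `[0%R, +oo[)
     ((1 - q t) ^+ (2 * m.+1) - (1 - 2 * q t) ^+ m.+1)%:E)%E.
Proof.
move=> S1; have S0 : 0 < S by lra.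
pose K t :=
  ((1 - 2 * q t) ^+ m.+1 - m.+1%:R / m.+2%:R * (1 - 2 * q t) ^+ m.+2) / 4.
pose f t := S / (1 + S ^+ 2) * (m.+1%:R * q t * (1 - 2 * q t) ^+ m * phi t).
have dK (t : R) : is_derive t 1 (fun t => S / (1 + S ^+ 2) * K t) (f t).
  have h1 := is_derive_exprn _ _ _ m.+1 (is_derive_1B2q t).
  have h2 := is_derive_exprn _ _ _ m.+2 (is_derive_1B2q t).
  apply: is_derive_eq; rewrite /f /GRing.scale/= (exprS (1 - 2 * q t)).
  have m0 : 0 <= m%:R :> R by []; have S20 := sqr_ge0 S.
  field; apply/andP; split; apply: lt0r_neq0; lra.
have cf : continuous f.
  move=> t; apply: cvgMr; apply: cvgM; last exact: continuous_std_normal_pdf.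
  apply: cvgM; first by apply: cvgMr; exact: continuous_gauss_tail.
  exact: (continuous_exprn _ _ continuous_1B2q).
have SS0 : 0 <= S / (1 + S ^+ 2).
  by rewrite divr_ge0 ?(ltW S0)// addr_ge0// sqr_ge0.
have g0 t : 0 <= t -> 0 <= (1 - q t) ^+ (2 * m.+1) - (1 - 2 * q t) ^+ m.+1.
  by move=> /gauss_tail_itv; exact: gap_ge0.
apply: (@le_trans _ _ (\int[mu]_(t in `[1%R, S]) (f t)%:E)%E); last first.
  apply: (@le_trans _ _ (\int[mu]_(t in `[1%R, S])
     ((1 - q t) ^+ (2 * m.+1) - (1 - 2 * q t) ^+ m.+1)%:E)%E).
    apply: ge0_le_integral_EFin => //.
    - move=> t /=; rewrite in_itv/= => /andP[t1 _].
      have /gauss_tail_itv/andP[? ?] : 0 <= t by lra.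
      by rewrite /f mulr_ge0// !mulr_ge0 ?normal_pdf_ge0 ?exprn_ge0//; lra.
    - move=> t /=; rewrite in_itv/= => /andP[t1 tS].
      have t0 : 0 <= t by lra.
      apply: (le_trans _ (gap_ge _ _ (gauss_tail_itv _ t0))).
      have h : S / (1 + S ^+ 2) * phi t <= q t.
        apply: (le_trans _ (gauss_tail_ge_mills t)).
        rewrite mulrC ler_wpM2l ?normal_pdf_ge0//.
        rewrite ler_pdivrMr ?ltr_pwDl ?sqr_ge0// mulrAC.
        rewrite ler_pdivlMr ?ltr_pwDl ?sqr_ge0// !expr2.
        (* This product is t (1 + S^2) - S (1 + t^2), the cross-multiplied comparison of the two
           Mills factors. *)
        have : 0 <= (S - t) * (S * t - 1) by rewrite mulr_ge0 ?subr_ge0//; nra.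
        lra.
      have /andP[q0 q1] := gauss_tail_itv _ t0.
      rewrite /f mulrCA.
      have -> : m.+1%:R * q t ^+ 2 * (1 - 2 * q t) ^+ m =
        (m.+1%:R * q t * (1 - 2 * q t) ^+ m) * q t by ring.
      rewrite ler_wpM2l// !mulr_ge0 ?exprn_ge0//; lra.
  apply: ge0_subset_integral => //.
  - apply/measurable_EFinP/measurable_funTS; apply: continuous_measurable_fun.
    exact: continuous_gap.
  - by move=> t /=; rewrite in_itv/= andbT lee_fin => /g0.
  - by move=> t /=; rewrite !in_itv/= andbT => /andP[t1 _]; lra.
have dK' (t : R) : derivable (fun t => S / (1 + S ^+ 2) * K t) t 1.
  exact: (ex_derive (is_derive := dK t)).
have cK : continuous (fun t => S / (1 + S ^+ 2) * K t).
  by move=> t; apply: differentiable_continuous; apply/derivable1_diffP.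
rewrite (@continuous_FTC2 _ f (fun t => S / (1 + S ^+ 2) * K t))//;
  last 3 first.
- exact: continuous_subspaceT.
- split.
  + by move=> t _.
  + by apply: cvg_at_right_filter; exact: cK.
  + by apply: cvg_at_left_filter; exact: cK.
- by move=> t _; have h := dK t; rewrite derive1E derive_val.
rewrite -EFinB lee_fin /= /GRing.scale/= -mulrBr ler_wpM2l// lerB//.
  have /andP[q0 q1] := gauss_tail_itv _ (ltW S0).
  have -> : K S =
      (1 - 2 * q S) ^+ m.+1 * (1 + 2 * m.+1%:R * q S) / (4 * m.+2%:R).
    rewrite /K (exprS _ m.+1); have m0 : 0 <= m%:R :> R by [].
    by field; apply: lt0r_neq0; lra.
  rewrite ler_wpM2r ?invr_ge0//.
  (* Bernoulli on the power makes [K S] a difference of squares: the linear terms cancel and the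
     loss is quadratic in n q(S). *)
  have -> : 1 - (2 * m.+1%:R * q S) ^+ 2 =
    (1 - m.+1%:R * (2 * q S)) * (1 + 2 * m.+1%:R * q S) by ring.
  rewrite ler_wpM2r//; first by rewrite addr_ge0// !mulr_ge0.
  by apply: bernoulli_ineq; lra.
rewrite /K ler_wpM2r// gerBl.
have /andP[q0 q1] := gauss_tail_itv _ (@ler01 R).
by rewrite mulr_ge0 ?divr_ge0 ?exprn_ge0//; lra.
Qed.

End gauss_integral_bounds.

(** * Both means expressed through three real numbers *)

Section mean_decomposition.
Context {R : realType}.
Notation mu := (@lebesgue_measure R).
Notation phi := (normal_pdf (0 : R) 1).
Notation q := (@gauss_tail R).

(** For n > 0, E [max_seq] over 2n variables is [max_pos_mean n - max_neg_mean n] and E [max_abs]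
    over n is [max_pos_mean n + max_gap_mean n]. *)
Definition max_pos_mean n : R :=
  fine (\int[mu]_(t in `[0%R, +oo[) (1 - (1 - q t) ^+ (2 * n))%:E)%E.

Definition max_neg_mean n : R :=
  fine (\int[mu]_(t in `[0%R, +oo[) (q t ^+ (2 * n))%:E)%E.

Definition max_gap_mean n : R := fine (\int[mu]_(t in `[0%R, +oo[)
  ((1 - q t) ^+ (2 * n) - (1 - 2 * q t) ^+ n)%:E)%E.

Lemma ge0_le_EFin_fineK (x : \bar R) (r : R) :
  (0 <= x)%E -> (x <= r%:E)%E -> (fine x)%:E = x.
Proof.
move=> x0 xr; apply: fineK; rewrite ge0_fin_numE//.
exact: le_lt_trans xr (ltry r).
Qed.

Let max_pos_ge0 (t : R) n : 0 <= t -> 0 <= 1 - (1 - q t) ^+ (2 * n).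
Proof.
move=> /gauss_tail_itv/andP[q0 q1].
by rewrite subr_ge0 exprn_ile1//; lra.
Qed.

Let max_gap_ge0 (t : R) m : 0 <= t ->
  0 <= (1 - q t) ^+ (2 * m.+1) - (1 - 2 * q t) ^+ m.+1.
Proof. by move=> /gauss_tail_itv; exact: gap_ge0. Qed.

Lemma max_pos_meanE n : (max_pos_mean n)%:E =
  (\int[mu]_(t in `[0%R, +oo[) (1 - (1 - q t) ^+ (2 * n))%:E)%E.
Proof.
(* The cut at 1 serves only finiteness; any positive cut would do. *)
apply: ge0_le_EFin_fineK (integral_max_tail_le _ 1 ltr01).
by apply: integral_ge0 => t /=; rewrite in_itv/= andbT lee_fin => /max_pos_ge0.
Qed.

(** At index 0 the integrand is 1 and the integral infinite, hence the successor. *)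
Lemma max_neg_meanE m : (max_neg_mean m.+1)%:E =
  (\int[mu]_(t in `[0%R, +oo[) (q t ^+ (2 * m.+1))%:E)%E.
Proof.
rewrite /max_neg_mean mulnS.
apply: ge0_le_EFin_fineK (integral_gauss_tailX_le _).
by apply: integral_ge0 => t _; rewrite lee_fin exprn_ge0// gauss_tail_ge0.
Qed.

Lemma max_gap_meanE m : (max_gap_mean m.+1)%:E =
  (\int[mu]_(t in `[0%R, +oo[)
     ((1 - q t) ^+ (2 * m.+1) - (1 - 2 * q t) ^+ m.+1)%:E)%E.
Proof.
apply: ge0_le_EFin_fineK (integral_gap_le _ 1 ltr01).
by apply: integral_ge0 => t /=; rewrite in_itv/= andbT lee_fin => /max_gap_ge0.
Qed.

Lemma max_neg_mean_ge0 n : 0 <= max_neg_mean n.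
Proof.
rewrite /max_neg_mean; apply: fine_ge0; apply: integral_ge0 => t _.
by rewrite lee_fin exprn_ge0// gauss_tail_ge0.
Qed.

Lemma max_neg_mean_le m : max_neg_mean m.+1 <= 2^-1 ^+ (2 * m).+1.
Proof.
rewrite -lee_fin max_neg_meanE mulnS; exact: integral_gauss_tailX_le.
Qed.

Lemma max_abs_mean_split m :
  (\int[mu]_(t in `[0%R, +oo[) (1 - (1 - 2 * q t) ^+ m.+1)%:E =
   (max_pos_mean m.+1 + max_gap_mean m.+1)%:E)%E.
Proof.
have cq : continuous (fun t => (1 - q t) ^+ (2 * m.+1)).
  apply: continuous_exprn => t.
  by apply: cvgB; [exact: cvg_cst|exact: continuous_gauss_tail].
have cq2 : continuous (fun t => (1 - 2 * q t) ^+ m.+1).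
  apply: continuous_exprn => t; apply: cvgB; first exact: cvg_cst.
  by apply: cvgMr; exact: continuous_gauss_tail.
rewrite EFinD max_pos_meanE max_gap_meanE -ge0_integralD//.
- by apply: eq_integral => t _; rewrite -EFinD; congr (_%:E); ring.
- by move=> t /=; rewrite in_itv/= andbT lee_fin => /max_pos_ge0.
- apply/measurable_EFinP/measurable_funTS; apply: continuous_measurable_fun.
  by move=> t; apply: cvgB; [exact: cvg_cst|exact: cq].
- by move=> t /=; rewrite in_itv/= andbT lee_fin => /max_gap_ge0.
- apply/measurable_EFinP/measurable_funTS; apply: continuous_measurable_fun.
  by move=> t; apply: cvgB; [exact: cq|exact: cq2].
Qed.

End mean_decomposition.

(** * Explicit estimates at the scale S = sqrt(2 ln n) *)

Section mean_asymptotics.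
Context {R : realType}.
Notation phi := (normal_pdf (0 : R) 1).
Notation q := (@gauss_tail R).
Notation peak := (@normal_peak R 1).

Let peak_gt0 : 0 < peak.
Proof. by rewrite normal_peak_gt0// oner_neq0. Qed.

Section fixed_scale.
Variables (m : nat) (S : R).
Let n : R := m.+1%:R.
Hypothesis hn : expR (S ^+ 2 / 2) = n.
Hypothesis S_ge : 10 <= S.
Hypothesis hS : 8 * 240 <= peak * (S - 1).

Let n_ge_sqr : S ^+ 2 <= n.
Proof.
have x0 : 0 <= S ^+ 2 / 2 by rewrite divr_ge0// sqr_ge0.
have := expR_ge1Dxn 1 x0; rewrite hn (_ : 2`! = 2%N)//.
apply: le_trans; have : 100 <= S ^+ 2 by rewrite expr2; have := S_ge; nra.
by move: (S ^+ 2) => y y100; rewrite expr2; nra.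
Qed.

Let n_ge : S <= n.
Proof. by apply: le_trans n_ge_sqr; rewrite expr2; have := S_ge; nra. Qed.

(** Since n = exp(S^2 / 2), n phi(S) is the constant [normal_peak 1], at most 1, and Mills' ratio
    leaves 1/S. *)
Lemma scaled_gauss_tail_le : n * q S <= S^-1.
Proof.
have S0 : 0 < S by have := S_ge; lra.
have n0 : 0 < n by rewrite -hn expR_gt0.
apply: (@le_trans _ _ (n * (phi S / S))).
  by rewrite ler_wpM2l ?(ltW n0)// gauss_tail_le_mills.
rewrite mulrA std_normal_pdfE mulNr expRN hn mulrCA divff ?gt_eqF// mulr1.
by rewrite -[leRHS]mul1r ler_wpM2r ?invr_ge0 ?(ltW S0)// std_normal_peak_le1.
Qed.

(* This is why the integrals are cut at [S - 1]: moving one unit to the left of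
   [S] multiplies [n phi] by about [e^S], which dominates every power of [S]. *)
Lemma scaled_gauss_tail_ge : 2 * S ^+ 2 <= n * q (S - 1).
Proof.
pose x := S - 1; have x1 : 9 <= x by rewrite /x; have := S_ge; lra.
have n0 : 0 < n by rewrite -hn expR_gt0.
have x0 : 0 < x by lra.
apply: (@le_trans _ _ (n * (phi x * (x / (1 + x ^+ 2))))); last first.
  by rewrite ler_wpM2l ?(ltW n0)// gauss_tail_ge_mills.
(* The exponent of n phi(x) is (S^2 - x^2) / 2 = S - 1/2, which exceeds x. *)
have h1 : peak * expR x <= n * phi x.
  rewrite std_normal_pdfE mulrCA ler_wpM2l ?(ltW peak_gt0)//.
  rewrite -hn -expRD ler_expR.
  by rewrite /x !expr2; lra.
have h2 : x ^+ 5 / 120 <= expR x.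
  have := expR_ge1Dxn 4 (ltW x0); rewrite (_ : 5`! = 120%N)//; lra.
have h3 : (2 * x)^-1 <= x / (1 + x ^+ 2).
  rewrite -[leLHS]mul1r ler_pdivrMr ?mulr_gt0// mulrAC ler_pdivlMr; last first.
    by rewrite ltr_pwDl// sqr_ge0.
  by rewrite expr2; nra.
apply: (@le_trans _ _ (peak * (x ^+ 5 / 120) * (2 * x)^-1)).
  (* The 240 is 2 * 5!, from [h3] and the fifth-order term of the exponential. Then [hS] bounds peak
     * x below by 8 * 240, leaving 8 x^3, which beats 2 (x + 1)^2. *)
  have -> : peak * (x ^+ 5 / 120) * (2 * x)^-1 = (peak * x) * x ^+ 3 / 240.
    by field; rewrite gt_eqF.
  apply: (@le_trans _ _ (8 * x ^+ 3)).
    rewrite (_ : S = x + 1); last by rewrite /x; ring.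
    rewrite !exprS expr0; nra.
  have : 0 <= x ^+ 3 by rewrite exprn_ge0// ltW.
  by rewrite ler_pdivlMr//; have := hS; rewrite -/x; nra.
rewrite [leRHS]mulrA; apply: ler_pM => //.
- by rewrite mulr_ge0 ?(ltW peak_gt0)// divr_ge0// exprn_ge0// ltW.
- by rewrite invr_ge0 mulr_ge0// ltW.
- by apply: le_trans h1; rewrite ler_wpM2l// ltW.
Qed.

(** As 2m >= m + 1 and 1 - q <= exp(-q), the power is at most exp(- n q(S - 1)) <= exp(- 2 S^2),
    which is n^-4. This absorbs the factor of order n^2 S^2 that multiplies it later. *)
Lemma expr_1Bgauss_tail_le : (1 - q (S - 1)) ^+ (2 * m) <= n ^- 4.
Proof.
have S1 : 0 <= S - 1 by have := S_ge; lra.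
have /andP[q0 q1] := gauss_tail_itv _ S1.
have m1 : (0 < m)%N.
  rewrite lt0n; apply: contraPneq n_ge => m0; rewrite /n m0.
  by have := S_ge; lra.
apply: (@le_trans _ _ ((1 - q (S - 1)) ^+ m.+1)).
  apply: ler_wiXn2l; [lra|lra|].
  by rewrite mul2n -addnn -addn1 leq_add2l.
apply: (@le_trans _ _ (expR (- q (S - 1)) ^+ m.+1)).
  rewrite lerXn2r ?nnegrE ?expR_ge0//; first lra.
  exact: expR_ge1Dx.
rewrite -expRM_natl -hn -expRM_natl -expRN ler_expR -/n.
by have := scaled_gauss_tail_ge; lra.
Qed.

(** A bounded error suffices, since the mean is later divided by [S]. The upper estimate cuts at
    [S], the lower one at [S - 1], and the negative part costs at most 1. *)
Lemma max_mean_near_scale :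
  `|max_pos_mean m.+1 - max_neg_mean m.+1 - S| <= 3.
Proof.
have S0 : 0 < S by have := S_ge; lra.
have n0 : 0 < n by rewrite -hn expR_gt0.
have S1 : 0 <= S - 1 by have := S_ge; lra.
have Cle : max_neg_mean m.+1 <= 1 :> R.
  by apply: (le_trans (max_neg_mean_le m)); rewrite exprn_ile1//; lra.
have C0 := @max_neg_mean_ge0 R m.+1.
have Ale : max_pos_mean m.+1 <= S + 1.
  rewrite -lee_fin max_pos_meanE.
  apply: (le_trans (integral_max_tail_le _ _ S0)); rewrite lee_fin lerD2l.
  rewrite natrM -/n -mulrA (mulrA n) ; have h := scaled_gauss_tail_le.
  have V1 : S^-1 <= 2^-1 by rewrite lef_pV2 ?posrE//; have := S_ge; lra.
  have V0 : 0 <= S^-1 by rewrite invr_ge0 ltW.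
  have qS0 : 0 <= n * q S by rewrite mulr_ge0 ?gauss_tail_ge0// ltW.
  nra.
have Age : S - 2 <= max_pos_mean m.+1.
  rewrite -lee_fin max_pos_meanE.
  apply: (le_trans _ (integral_max_tail_ge _ _ S1)); rewrite lee_fin.
  have /andP[q0 q1] := gauss_tail_itv _ S1.
  have : (1 - q (S - 1)) ^+ (2 * m.+1) <= n ^- 4.
    apply: (le_trans _ expr_1Bgauss_tail_le).
    by apply: ler_wiXn2l; [lra|lra|rewrite leq_pmul2l].
  have : n ^- 4 <= S^-1.
    rewrite lef_pV2 ?posrE ?exprn_gt0//; apply: (le_trans n_ge).
    by rewrite -[leLHS]expr1 ler_weXn2l//; have := n_ge; have := S_ge; lra.
  have : S * S^-1 = 1 by rewrite divff// gt_eqF.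
  have V0 : 0 < S^-1 by rewrite invr_gt0.
  move: ((1 - q (S - 1)) ^+ (2 * m.+1)) (n ^- 4) (S^-1) V0 => a b c c0 cS bc ab.
  nra.
by rewrite ler_norml; apply/andP; split; lra.
Qed.

Let invS_itv : 0 < S^-1 <= 10^-1.
Proof.
have S0 : 0 < S by have := S_ge; lra.
by rewrite invr_gt0 S0/= lef_pV2 ?posrE// S_ge.
Qed.

Let invn_le : n^-1 <= S^-1 ^+ 2.
Proof.
have S0 : 0 < S by have := S_ge; lra.
have n0 : 0 < n by rewrite -hn expR_gt0.
by rewrite exprVn lef_pV2 ?posrE ?exprn_gt0// n_ge_sqr.
Qed.

(** 11 = 2 + 4 + 5: the negative part, the range left of [S - 1], and the excess of the main term
    over 1. *)
Lemma scaled_max_gap_le :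
  4 * n * S * (max_neg_mean m.+1 + max_gap_mean m.+1) <= 1 + 11 / S.
Proof.
have S0 : 0 < S by have := S_ge; lra.
have S10 : 0 < S - 1 by have := S_ge; lra.
have n0 : 0 < n by rewrite -hn expR_gt0.
have n1 : 1 <= n by have := n_ge; have := S_ge; lra.
have /andP[V0 V1] := invS_itv.
have h1 : 4 * n * S * max_neg_mean m.+1 <= 2 / S.
  apply: (@le_trans _ _ (4 * n * S * (2 * n ^+ 2)^-1)).
    rewrite ler_wpM2l// ?mulr_ge0 ?(ltW n0) ?(ltW S0)//.
    apply: (le_trans (max_neg_mean_le m)).
    rewrite exprVn lef_pV2 ?posrE ?mulr_gt0 ?exprn_gt0// (exprS 2) ler_wpM2l//.
    rewrite mulnC exprM lerXn2r ?nnegrE ?(ltW n0) ?exprn_ge0//.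
    by rewrite -natrX ler_nat ltn_expl.
  have -> : 4 * n * S * (2 * n ^+ 2)^-1 = 2 * S * n^-1.
    by field; rewrite gt_eqF.
  apply: (@le_trans _ _ (2 * S * S^-1 ^+ 2)).
    by rewrite ler_wpM2l// mulr_ge0// ltW.
  by rewrite le_eqVlt; apply/orP; left; apply/eqP; field; rewrite gt_eqF.
have h2 : 4 * n * S * (n * (S - 1) * (1 - q (S - 1)) ^+ (2 * m)) <= 4 / S.
  apply: (@le_trans _ _ (4 * n * S * (n * S * n ^- 4))).
    rewrite ler_wpM2l ?mulr_ge0 ?(ltW n0) ?(ltW S0)//.
    apply: ler_pM; rewrite ?expr_1Bgauss_tail_le//.
    - by rewrite mulr_ge0 ?(ltW n0)// ltW.
    - have /andP[q0 q1] := gauss_tail_itv _ (ltW S10).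
      by rewrite exprn_ge0//; lra.
    - by rewrite ler_wpM2l ?(ltW n0)//; lra.
  have -> : 4 * n * S * (n * S * n ^- 4) = 4 * S ^+ 2 * (n^-1 * n^-1).
    by field; rewrite gt_eqF.
  apply: (@le_trans _ _ (4 * S ^+ 2 * (S^-1 ^+ 2 * S^-1 ^+ 2))).
    apply: ler_wpM2l; first by rewrite mulr_ge0 ?exprn_ge0 ?(ltW S0).
    by rewrite ler_pM// invr_ge0 ltW.
  have -> : 4 * S ^+ 2 * (S^-1 ^+ 2 * S^-1 ^+ 2) = 4 * (S^-1 * S^-1).
    by field; rewrite gt_eqF.
  nra.
(* The left side is S/(S - 1) times 2n/(2n - 1); both factors are 1 + O(1/S) because n >= S. *)
have h3 : 4 * n * S * ((S - 1)^-1 * (2 * (2 * m).+1%:R)^-1) <= 1 + 5 / S.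
  have -> : (2 * m).+1%:R = 2 * n - 1 :> R.
    by rewrite /n -!natr1 natrM; ring.
  have d0 : 0 < 2 * n - 1 by lra.
  have -> : 4 * n * S * ((S - 1)^-1 * (2 * (2 * n - 1))^-1) =
      (2 * n * S) / ((S - 1) * (2 * n - 1)).
    by field; rewrite !gt_eqF.
  rewrite ler_pdivrMr ?mulr_gt0//.
  have -> : (1 + 5 / S) * ((S - 1) * (2 * n - 1)) =
     (S + 5) * ((S - 1) * (2 * n - 1)) / S by field; rewrite gt_eqF.
  rewrite ler_pdivlMr//; have := n_ge; have := S_ge; nra.
have hF : max_gap_mean m.+1 <= n * (S - 1) * (1 - q (S - 1)) ^+ (2 * m) +
    (S - 1)^-1 * (2 * (2 * m).+1%:R)^-1.
  by rewrite -lee_fin max_gap_meanE; exact: integral_gap_le.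
have nS0 : 0 <= 4 * n * S by rewrite !mulr_ge0 ?ltW.
have h4 := ler_wpM2l nS0 hF; rewrite (mulrDr (4 * n * S)) in h4.
rewrite (mulrDr (4 * n * S)).
apply: (le_trans (lerD h1 (le_trans h4 (lerD h2 h3)))); lra.
Qed.

(** 6 = 1 + 1 + 4: the losses from S^2/(1 + S^2), from n/(n + 1), and from the range beyond [S]. The
    last constant pays for the lower end 1, where n (1 - 2 q(1))^n is negligible. *)
Lemma scaled_max_gap_ge :
  1 - (6 + (2 * q 1 ^+ 2)^-1) / S <=
  4 * n * S * (max_neg_mean m.+1 + max_gap_mean m.+1).
Proof.
have S0 : 0 < S by have := S_ge; lra.
have S1 : 1 < S by have := S_ge; lra.
have n0 : 0 < n by rewrite -hn expR_gt0.
have /andP[V0 V1] := invS_itv.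
have q1 := @gauss_tail_gt0 R 1.
set c := (2 * q 1 ^+ 2)^-1.
have c0 : 0 <= c by rewrite invr_ge0 mulr_ge0// sqr_ge0.
have C0 := @max_neg_mean_ge0 R m.+1.
have hF : S / (1 + S ^+ 2) * ((1 - (2 * n * q S) ^+ 2) / (4 * m.+2%:R)
     - (1 - 2 * q 1) ^+ m.+1 / 4) <= max_gap_mean m.+1.
  by rewrite -lee_fin max_gap_meanE; exact: integral_gap_ge.
have nS0 : 0 <= 4 * n * S by rewrite !mulr_ge0 ?ltW.
apply: (@le_trans _ _ (4 * n * S * max_gap_mean m.+1)); last first.
  by rewrite ler_wpM2l// lerDr.
apply: (le_trans _ (ler_wpM2l nS0 hF)).
pose f := S ^+ 2 / (1 + S ^+ 2).
pose X := n / m.+2%:R * (1 - (2 * n * q S) ^+ 2) - n * (1 - 2 * q 1) ^+ m.+1.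
have S20 : 0 < 1 + S ^+ 2 by rewrite ltr_pwDl// sqr_ge0.
have -> : 4 * n * S * (S / (1 + S ^+ 2) *
    ((1 - (2 * n * q S) ^+ 2) / (4 * m.+2%:R) - (1 - 2 * q 1) ^+ m.+1 / 4)) =
    f * X.
  rewrite /f /X -[m.+2%:R]natr1 -/n.
  by field; rewrite (gt_eqF S20) gt_eqF//; lra.
have f_ge : 1 - S^-1 <= f.
  rewrite /f ler_pdivlMr//.
  have -> : (1 - S^-1) * (1 + S ^+ 2) = 1 + S ^+ 2 - S - S^-1.
    by field; rewrite gt_eqF.
  lra.
have f_le1 : f <= 1 by rewrite /f ler_pdivrMr//; lra.
have f0 : 0 <= f by rewrite /f divr_ge0 ?sqr_ge0// ltW.
have hsq : (2 * n * q S) ^+ 2 <= 4 / S.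
  have h := scaled_gauss_tail_le.
  have h0 : 0 <= n * q S by rewrite mulr_ge0 ?gauss_tail_ge0// ltW.
  rewrite -mulrA exprMn expr2.
  have : (n * q S) ^+ 2 <= S^-1 * S^-1 by rewrite expr2 ler_pM.
  nra.
have hr : 1 - S^-1 <= n / m.+2%:R.
  rewrite -[m.+2%:R]natr1 -/n ler_pdivlMr; last lra.
  have : n * S^-1 >= 1 by rewrite ler_pdivlMr// mul1r n_ge.
  nra.
have hr1 : n / m.+2%:R <= 1.
  by rewrite -[m.+2%:R]natr1 -/n ler_pdivrMr; lra.
have hv : n * (1 - 2 * q 1) ^+ m.+1 <= c / S.
  have /andP[_ q2] := gauss_tail_itv _ (@ler01 R).
  have : (1 - 2 * q 1) ^+ m.+1 <= expR (- (n * (2 * q 1))).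
    apply: (@le_trans _ _ (expR (- (2 * q 1)) ^+ m.+1)).
      rewrite lerXn2r ?nnegrE ?expR_ge0//; first lra.
      exact: expR_ge1Dx.
    by rewrite -expRM_natl mulrN.
  rewrite expRN.
  have y0 : 0 <= n * (2 * q 1) by rewrite !mulr_ge0 ?ltW.
  (* The quadratic term of the exponential is enough: it leaves c / n <= c / S and fixes the value
     of [c]. *)
  have ey : 2 * (n * q 1) ^+ 2 <= expR (n * (2 * q 1)).
    have := expR_ge1Dxn 1 y0; rewrite (_ : 2`! = 2%N)//.
    by rewrite !expr2; lra.
  move=> hv; apply: (@le_trans _ _ (n * (2 * (n * q 1) ^+ 2)^-1)).
    rewrite ler_wpM2l ?(ltW n0)//; apply: (le_trans hv).
    by rewrite lef_pV2 ?posrE ?expR_gt0// mulr_gt0// exprn_gt0// mulr_gt0.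
  have -> : n * (2 * (n * q 1) ^+ 2)^-1 = c * n^-1.
    by rewrite /c; field; rewrite !gt_eqF.
  rewrite ler_wpM2l// lef_pV2 ?posrE//; exact: n_ge.
have X_ge : 1 - (5 + c) / S <= X.
  have : 0 <= (n / m.+2%:R - (1 - S^-1)) * (1 - 4 / S).
    by rewrite mulr_ge0 ?subr_ge0//; lra.
  have : n / m.+2%:R * (1 - 4 / S) <= n / m.+2%:R * (1 - (2 * n * q S) ^+ 2).
    by rewrite ler_wpM2l// ?divr_ge0 ?(ltW n0)//; lra.
  have z0 : 0 <= S^-1 * S^-1 by rewrite mulr_ge0// ltW.
  have -> : (5 + c) / S = 5 / S + c / S by ring.
  rewrite /X; move: (n / m.+2%:R * (1 - (2 * n * q S) ^+ 2)) hv.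
  move: (n * (1 - 2 * q 1) ^+ m.+1) (c / S) (n / m.+2%:R) z0 => w cz p z0 y wcz.
  lra.
apply: (@le_trans _ _ (f * (1 - (5 + c) / S))); last by rewrite ler_wpM2l.
(* The factor 1 - (5 + c) / S may be negative, so [f <= 1] is used on the subtracted term and [f_ge]
   on the leading one. *)
have : 0 <= (5 + c) / S by rewrite divr_ge0 ?addr_ge0// ltW.
have -> : (6 + c) / S = S^-1 + (5 + c) / S by ring.
nra.
Qed.

End fixed_scale.
End mean_asymptotics.

(** * Passage to the limit *)

Section limits.
Context {R : realType}.

(* Chosen so that [n * expR (- S ^+ 2 / 2) = 1]. *)
Definition max_scale (n : nat) : R := Num.sqrt (2 * ln n%:R).

Lemma max_scale_cvgy : max_scale n @[n --> \oo] --> +oo.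
Proof.
apply/cvgryPge => A; near=> n.
have An : expR (A ^+ 2 / 2) <= n%:R.
  by near: n; exact: nbhs_infty_ger.
rewrite /max_scale (le_trans (ler_norm A))// -sqrtr_sqr ler_wsqrtr//.
suff : A ^+ 2 / 2 <= ln n%:R by lra.
rewrite -ler_expR lnK// posrE; exact: lt_le_trans (expR_gt0 _) An.
Unshelve. all: by end_near. Qed.

Lemma max_scaleV_cvg0 : (max_scale n)^-1 @[n --> \oo] --> 0.
Proof.
apply: (gtr0_cvgV0 _).2; last exact: max_scale_cvgy.
by near=> n; near: n; apply: cvgry_gt; exact: max_scale_cvgy.
Unshelve. all: by end_near. Qed.

Lemma expR_max_scale n : (0 < n)%N -> expR (max_scale n ^+ 2 / 2) = n%:R.
Proof.
move=> n0; rewrite /max_scale sqr_sqrtr; last first.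
  by rewrite mulr_ge0// ln_ge0// ler1n.
by rewrite mulrAC divff// mul1r lnK// posrE ltr0n.
Qed.

Let max_mean n : R := max_pos_mean n - max_neg_mean n.
Let mean_gap n : R := max_neg_mean n + max_gap_mean n.

Lemma near_max_scale : \forall n \near \oo, [/\ (0 < n)%N,
  10 <= max_scale n & 8 * 240 <= normal_peak 1 * (max_scale n - 1)].
Proof.
near=> n; split.
- by near: n; exact: nbhs_infty_gt.
- by near: n; apply: cvgry_ge; exact: max_scale_cvgy.
- rewrite [leRHS]mulrC -ler_pdivrMr ?normal_peak_gt0 ?oner_neq0//.
  rewrite lerBrDr; near: n; apply: cvgry_ge; exact: max_scale_cvgy.
Unshelve. all: by end_near. Qed.

Lemma max_mean_cvg : max_mean n / max_scale n @[n --> \oo] --> (1 : R).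
Proof.
have h3 : 3 * (max_scale n)^-1 @[n --> \oo] --> 0.
  by rewrite -[X in _ --> X](mulr0 3); apply: cvgMr; exact: max_scaleV_cvg0.
apply: (@squeeze_cvgr _ _ _ _ (fun n => 1 - 3 * (max_scale n)^-1)
    (fun n => 1 + 3 * (max_scale n)^-1)); last 2 first.
- by rewrite -[X in _ --> X](subr0 1); apply: cvgB => //; exact: cvg_cst.
- by rewrite -[X in _ --> X](addr0 1); apply: cvgD => //; exact: cvg_cst.
apply: filterS near_max_scale => -[|m] [//= _ S10 Sp].
have S0 : 0 < max_scale m.+1 by lra.
have := max_mean_near_scale m _ (expR_max_scale _ (ltn0Sn m)) S10 Sp.
rewrite ler_distl => /andP[h1 h2].
have lE : (1 - 3 * (max_scale m.+1)^-1) * max_scale m.+1 = max_scale m.+1 - 3.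
  by field; rewrite gt_eqF.
have uE : (1 + 3 * (max_scale m.+1)^-1) * max_scale m.+1 = max_scale m.+1 + 3.
  by field; rewrite gt_eqF.
by rewrite ler_pdivlMr// ler_pdivrMr// lE uE h1 h2.
Qed.

Lemma mean_gap_cvg :
  4 * n%:R * max_scale n * mean_gap n @[n --> \oo] --> (1 : R).
Proof.
pose K : R := 6 + (2 * gauss_tail 1 ^+ 2)^-1.
have h k : k * (max_scale n)^-1 @[n --> \oo] --> 0.
  by rewrite -[X in _ --> X](mulr0 k); apply: cvgMr; exact: max_scaleV_cvg0.
apply: (@squeeze_cvgr _ _ _ _ (fun n => 1 - K * (max_scale n)^-1)
    (fun n => 1 + 11 * (max_scale n)^-1)); last 2 first.
- by rewrite -[X in _ --> X](subr0 1); apply: cvgB => //; exact: cvg_cst.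
- by rewrite -[X in _ --> X](addr0 1); apply: cvgD => //; exact: cvg_cst.
apply: filterS near_max_scale => -[|m] [//= _ S10 Sp].
have hn := expR_max_scale _ (ltn0Sn m).
by rewrite (scaled_max_gap_ge m _ hn S10) (scaled_max_gap_le m _ hn S10 Sp).
Qed.

(** The wanted identity solved for the error term: as 8 n ln n = 4 n S^2, one factor [S] goes to the
    gap and the other to the mean, so that numerator and denominator each tend to 1. *)
Definition max_ratio_error n : R :=
  (4 * n%:R * max_scale n * mean_gap n) / (max_mean n / max_scale n) - 1.

Lemma max_ratio_error_cvg0 : max_ratio_error n @[n --> \oo] --> 0.
Proof.
rewrite -[X in _ --> X](subrr 1); apply: cvgB; last exact: cvg_cst.
rewrite -[X in _ --> X](divr1 1); apply: cvgM; first exact: mean_gap_cvg.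
by apply: cvgV; [exact: oner_neq0|exact: max_mean_cvg].
Qed.

Lemma near_max_mean_ratio : \forall n \near \oo,
  max_pos_mean n + max_gap_mean n =
  (1 + (1 + max_ratio_error n) / (8 * n%:R * ln n%:R)) * max_mean n.
Proof.
have hM : \forall n \near \oo, 0 < max_mean n / max_scale n.
  by have := max_mean_cvg => /cvgr_gt; apply.
near=> n.
have [n0 S10 _] : [/\ (0 < n)%N, 10 <= max_scale n
    & 8 * 240 <= normal_peak 1 * (max_scale n - 1)].
  by near: n; exact: near_max_scale.
have S0 : 0 < max_scale n by lra.
have M0 : 0 < max_mean n.
  by rewrite -(pmulr_lgt0 _ (_ : 0 < (max_scale n)^-1)) ?invr_gt0//; near: n.
have nR0 : 0 < n%:R :> R by rewrite ltr0n.
have lnE : 8 * n%:R * ln n%:R = 4 * n%:R * max_scale n ^+ 2.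
  by rewrite -[in LHS](expR_max_scale _ n0) expRK expR_max_scale//; field.
rewrite lnE /max_ratio_error [1 + (_ - 1)]addrC subrK.
have -> : max_pos_mean n + max_gap_mean n = max_mean n + mean_gap n.
  by rewrite /max_mean /mean_gap; ring.
by field; rewrite !gt_eqF.
Unshelve. all: by end_near. Qed.

End limits.

Theorem theorem2p3 (R : realType) (d : measure_display) (T : measurableType d)
  (P : probability T R) (eta : nat -> {RV P >-> R})
  (hgauss : forall i (A : set R), measurable A ->
     distribution P (eta i) A = normal_prob 0 1 A)
  (hindep : mutually_independent P (fun i => eta i : T -> R)) :
  exists e : nat -> R, e n @[n --> \oo] --> 0 /\
    \forall n \near \oo,
      ('E_P[max_abs (fun i => eta i : T -> R) n] =
       (1 + (1 + e n) / (8 * n%:R * ln n%:R))%:E *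
       'E_P[max_seq (fun i => eta i : T -> R) (2 * n)%N])%E.
Proof.
exists (@max_ratio_error R); split; first exact: max_ratio_error_cvg0.
(* A positive index is required by the tail formula for [max_seq] and by the finiteness of
   [max_neg_mean]. *)
apply: filterS2 (@near_max_mean_ratio R) (nbhs_infty_gt 0) => -[//|m] hm _.
rewrite (expectation_max_abs _ hgauss hindep).
rewrite (expectation_max_seq _ hgauss hindep)//.
by rewrite max_abs_mean_split -max_pos_meanE -max_neg_meanE -EFinB -EFinM hm.
Qed.
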